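(* Let $R$ be a PID, equipped with the discrete topology, and let $X$ be a metrizable generalized continuum. Then there is an isomorphism of $R$-modules $\eta:H^0_{\mathrm e}(X)\to C(E(X),R)$, where $C(E(X),R)$ is the set of continuous functions $E(X)\to R$ with pointwise operations.
   Context: Spaces are Hausdorff. A generalized continuum is a Hausdorff space that is connected, locally connected, $\sigma$-compact, and locally compact. A subset of $X$ is bounded if its closure in $X$ is compact and unbounded otherwise. A compact exhaustion of $X$ is a sequence $K_1\subseteq K_2\subseteq\cdots$ of compact subspaces covering $X$ with $K_i\subseteq \mathrm{Int}\,K_{i+1}$; every generalized continuum has one. Given $\{K_i\}$, let $V_i=X-K_i$. An end of $X$ is a sequence $(W_1,W_2,\ldots)$ with $W_1\supseteq W_2\supseteq\cdots$ and $W_i$ an unbounded component of $V_i$. The end space $E(X)=E(X;\{K_i\})$ is the set of ends with the topology having as basis the sets $\{(W_1,W_2,\dots)\mid W_k=V\}$ for $k\ge1$ and $V$ an unbounded component of $V_k$; it is independent of the exhaustion up to canonical homeomorphism. End cohomology: $H^{0}_{\mathrm e}(X)=\varinjlim_K H^{0}(X-K;R)$, the direct limit over compacta $K\subseteq X$ (ordered by inclusion) of singular cohomology with restriction homomorphisms. *)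

(* Defs.v *)
From HB Require Import structures.
From mathcomp Require Import all_boot all_order all_algebra.
From mathcomp Require Import all_classical all_reals all_analysis.

Set Implicit Arguments.
Unset Strict Implicit.
Unset Printing Implicit Defensive.

Import Order.TTheory GRing.Theory Num.Theory.
Import numFieldNormedType.Exports.

Local Open Scope classical_set_scope.
Local Open Scope quotient_scope.
Local Open Scope ring_scope.

Section PrincipalIdealDomain.
Variable R : idomainType.

(* The improper ideal is allowed, unlike in [idealr_closed]. *)
Definition is_ideal (I : set R) : Prop :=
  [/\ I 0, forall x y, I x -> I y -> I (x + y) & forall a x, I x -> I (a * x)].

Definition is_PID : Prop :=
  forall I : set R, is_ideal I -> exists a, I = range ( *%R a).

End PrincipalIdealDomain.

Section Spaces.
Variable X : topologicalType.

Definition bounded_subset (A : set X) : Prop := compact (closure A).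

Definition locally_connected_space : Prop :=
  forall (x : X) (U : set X), nbhs x U ->
    exists V : set X, [/\ open V, V x, connected V & V `<=` U].

Definition sigma_compact_space : Prop :=
  exists2 C : nat -> set X,
    (forall n, compact (C n)) & \bigcup_n C n = [set: X].

Definition generalized_continuum : Prop :=
  [/\ hausdorff_space X, connected [set: X], locally_connected_space,
      sigma_compact_space & locally_compact [set: X]].

(* [F] is a model of the real line: all [realType]s are isomorphic. *)
Definition metrizable (F : realType) : Prop :=
  exists d : X -> X -> F,
    [/\ forall x y, d x y = 0 <-> x = y,
        forall x y, d x y = d y x,
        forall x y z, d x z <= d x y + d y z &
        forall (x : X) (A : set X),
          nbhs x A <-> exists2 e : F, 0 < e & [set y | d x y < e] `<=` A].

(* Indexed from 0; [K i `<=` K i.+1] follows from the second clause. *)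
Definition compact_exhaustion (K : nat -> set X) : Prop :=
  [/\ forall i, compact (K i),
      forall i, K i `<=` (K i.+1)^° &
      \bigcup_i K i = [set: X]].

Definition is_component (A C : set X) : Prop :=
  exists2 x, A x & C = connected_component A x.

Definition unbounded_component (A C : set X) : Prop :=
  is_component A C /\ ~ bounded_subset C.

Lemma is_component_eq (A C D : set X) :
  is_component A C -> is_component A D -> C `&` D !=set0 -> C = D.
Proof.
move=> [x Ax ->] [y Ay ->] [z [/same_connected_component -> ]].
by move=> /same_connected_component ->.
Qed.

Lemma is_component_neq0 (A C : set X) : is_component A C -> C !=set0.
Proof. by move=> [x Ax ->]; exists x; exact: connected_component_refl. Qed.

End Spaces.

Section EndSpace.
Variables (X : topologicalType) (K : nat -> set X).

Record end_space : Type := EndOf {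
  end_seq :> nat -> set X;
  end_decr : forall i, end_seq i.+1 `<=` end_seq i;
  end_unbounded : forall i, unbounded_component (~` K i) (end_seq i) }.

HB.instance Definition _ := gen_eqMixin end_space.
HB.instance Definition _ := gen_choiceMixin end_space.

Definition end_basis (p : nat * set X) : set end_space :=
  [set W : end_space | W p.1 = p.2].

Definition end_basis_dom : set (nat * set X) :=
  [set p | unbounded_component (~` K p.1) p.2].

Lemma end_decr_le (W : end_space) i j : (i <= j)%N -> W j `<=` W i.
Proof.
move=> /subnK <-; elim: (j - i)%N => // n IHn.
by apply: subset_trans IHn; exact: end_decr.
Qed.

Lemma end_eq_le (W W' : end_space) i j :
  (i <= j)%N -> W j = W' j -> W i = W' i.
Proof.
move=> ij e; apply: (@is_component_eq _ (~` K i)).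
- by case: (end_unbounded W i).
- by case: (end_unbounded W' i).
- have [x Wx] : W j !=set0.
    by case: (end_unbounded W j) => /is_component_neq0.
  exists x; split; first exact: (end_decr_le ij).
  by apply: (end_decr_le ij); rewrite -e.
Qed.

Lemma end_basis_cover : \bigcup_(p in end_basis_dom) end_basis p = setT.
Proof.
apply/seteqP; split=> // W _.
by exists (0%N, W 0%N) => //; exact: end_unbounded.
Qed.

Lemma end_basis_join p q (W : end_space) :
  end_basis_dom p -> end_basis_dom q -> end_basis p W -> end_basis q W ->
  exists r, [/\ end_basis_dom r, end_basis r W &
                end_basis r `<=` end_basis p `&` end_basis q].
Proof.
move=> _ _ Wp Wq; exists (maxn p.1 q.1, W (maxn p.1 q.1)); split.
- exact: end_unbounded.
- by [].
- move=> W' /= e; split; rewrite /end_basis /=.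
    by rewrite -Wp; apply: (end_eq_le (leq_maxl _ q.1)).
  by rewrite -Wq; apply: (end_eq_le (leq_maxr p.1 _)).
Qed.

HB.instance Definition _ := isBaseTopological.Build end_space
  end_basis_cover end_basis_join.

End EndSpace.

Section ContinuousFunctions.
Variables (E : topologicalType) (R : idomainType).

Definition continuous_discrete : {pred E -> R^o} :=
  fun f => `[< continuous (f : E -> discrete_topology R) >].

Lemma continuous_discreteP (f : E -> R^o) :
  reflect (forall x, \forall y \near x, f y = f x) (f \in continuous_discrete).
Proof.
apply: (iffP (asboolP _)) => fc x.
- exact: (fc x [set f x] (@discrete_set1 (discrete_topology R) (f x))).
- move=> A /nbhs_singleton Afx; change (nbhs x (f @^-1` A)).
  have := fc x; apply: filterS => y /= yx.
  by rewrite yx.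
Qed.

Lemma continuous_discrete_submod : submod_closed continuous_discrete.
Proof.
split=> [|a f g /continuous_discreteP fc /continuous_discreteP gc].
  by apply/continuous_discreteP => x; exact: nearW.
apply/continuous_discreteP => x.
by apply: filterS2 (fc x) (gc x) => y fy gy; congr (_ * _ + _).
Qed.

HB.instance Definition _ :=
  GRing.isSubmodClosed.Build R (E -> R^o) continuous_discrete
    continuous_discrete_submod.

Record contfun : Type := ContFun {
  contfun_val :> E -> R^o;
  contfun_valP : contfun_val \in continuous_discrete }.

HB.instance Definition _ := [isSub for contfun_val].
HB.instance Definition _ := [Choice of contfun by <:].
HB.instance Definition _ := [SubChoice_isSubLmodule of contfun by <:].

End ContinuousFunctions.
Arguments contfun : clear implicits.

Section StandardSimplex.
Variable F : realType.

Definition std_simplex n : set 'rV[F]_n.+1 :=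
  [set x | (forall i, 0 <= x ord0 i) /\ \sum_i x ord0 i = 1].
Arguments std_simplex : clear implicits.

(* Insert the coordinate 0 at position [i]. *)
Definition face_row n (i : 'I_n.+2) (x : 'rV[F]_n.+1) : 'rV[F]_n.+2 :=
  \row_j (if unlift i j is Some k then x ord0 k else 0).

Lemma face_row_simplex n i (x : std_simplex n) :
  face_row i (set_val x) \in std_simplex n.+1.
Proof.
have [x0 x1] : std_simplex n (set_val x) by exact: set_valP.
apply/mem_set; split=> [j|].
  by rewrite mxE; case: unliftP.
rewrite (bigD1_ord i) //= mxE unlift_none add0r -[RHS]x1.
by apply: eq_bigr => j _; rewrite mxE liftK.
Qed.

Definition face_fun n i (x : std_simplex n) : std_simplex n.+1 :=
  exist _ (face_row i (set_val x)) (face_row_simplex i x).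

Lemma face_row_continuous n i : continuous (@face_row n i).
Proof.
move=> x A [B nB BA]; rewrite nbhs_simpl /=.
exists (fun _ k => B ord0 (lift i k)).
  move=> a k; rewrite [a]ord1.
  by have := nB ord0 (lift i k); rewrite mxE liftK.
move=> y yB; apply: BA => a j; rewrite [a]ord1 mxE.
have := nB ord0 j; rewrite mxE; case: unliftP => [k ->|-> /nbhs_singleton//].
by move=> _; exact: yB.
Qed.

Lemma face_continuous n i : continuous (@face_fun n i).
Proof.
apply: continuous_comp_initial => x.
apply: (@continuous_comp _ _ _ set_val (@face_row n i)).
  exact: initial_continuous.
exact: face_row_continuous.
Qed.

Definition face n i : continuousType (std_simplex n) (std_simplex n.+1) :=
  mkcts (@face_continuous n i).

End StandardSimplex.
Arguments std_simplex : clear implicits.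

Definition ctscomp (X Y Z : topologicalType) (g : continuousType Y Z)
  (f : continuousType X Y) : continuousType X Z := g \o f.

Section SingularCohomology.
Variables (F : realType) (R : idomainType).

Definition singular_simplex (n : nat) (Y : topologicalType) : Type :=
  continuousType (std_simplex F n) Y.

(* R-linear maps from the free R-module on the singular n-simplices to R. *)
Definition cochain (n : nat) (Y : topologicalType) : Type :=
  singular_simplex n Y -> R^o.
HB.instance Definition _ n Y := GRing.Lmodule.on (cochain n Y).

Definition coboundary n Y (c : cochain n Y) : cochain n.+1 Y :=
  fun s => \sum_(i < n.+2) (-1) ^+ i *: c (ctscomp s (face F i)).

Lemma coboundary_is_linear n Y : linear (@coboundary n Y).
Proof.
move=> a c d; apply/funext => s.
rewrite /GRing.add /= /GRing.scale /= scaler_sumr -big_split /=.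
apply: eq_bigr => i _.
have -> : (a \*: c \+ d) (ctscomp s (face F i)) =
  a *: c (ctscomp s (face F i)) + d (ctscomp s (face F i)) by [].
by rewrite scalerDr !scalerA mulrC.
Qed.

HB.instance Definition _ n Y :=
  GRing.isLinear.Build R (cochain n Y) (cochain n.+1 Y) *:%R
    (@coboundary n Y) (@coboundary_is_linear n Y).

(* There are no cochains in degree -1, so H^0 is the kernel of the coboundary
   in degree 0. *)
Definition cocycle0 Y : {pred cochain 0 Y} := fun c => coboundary c == 0.

Lemma cocycle0_submod Y : submod_closed (@cocycle0 Y).
Proof.
split=> [|a c d]; rewrite !unfold_in /=; first by rewrite linear0.
by move=> /eqP c0 /eqP d0; rewrite linearP /= c0 d0 scaler0 addr0.
Qed.

HB.instance Definition _ Y :=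
  GRing.isSubmodClosed.Build R (cochain 0 Y) (@cocycle0 Y) (@cocycle0_submod Y).

Record singular_H0 (Y : topologicalType) : Type := SingularH0 {
  H0_cochain : cochain 0 Y;
  H0_cochainP : H0_cochain \in @cocycle0 Y }.

HB.instance Definition _ Y := [isSub for @H0_cochain Y].
HB.instance Definition _ Y := [Choice of singular_H0 Y by <:].
HB.instance Definition _ Y := [SubChoice_isSubLmodule of singular_H0 Y by <:].

Section Pullback.
Variables (Y Z : topologicalType) (f : continuousType Y Z).

Definition cochain_pullback n (c : cochain n Z) : cochain n Y :=
  fun s => c (ctscomp f s).

Lemma coboundary_pullback n (c : cochain n Z) :
  coboundary (cochain_pullback c) = cochain_pullback (coboundary c).
Proof.
apply/funext => s; apply: eq_bigr => i _.
by congr (_ *: c _); apply/continuousEP.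
Qed.

Lemma H0_pullback_subproof (c : singular_H0 Z) :
  cochain_pullback (H0_cochain c) \in @cocycle0 Y.
Proof.
have /eqP c0 := H0_cochainP c.
by rewrite unfold_in /= coboundary_pullback c0.
Qed.

Definition H0_pullback (c : singular_H0 Z) : singular_H0 Y :=
  SingularH0 (H0_pullback_subproof c).

Lemma H0_pullback_is_linear : linear H0_pullback.
Proof. by move=> a c d; exact: val_inj. Qed.

HB.instance Definition _ :=
  GRing.isLinear.Build R (singular_H0 Z) (singular_H0 Y) *:%R
    H0_pullback H0_pullback_is_linear.

End Pullback.
End SingularCohomology.

Record directed_system (R : pzRingType) : Type := DirectedSystem {
  ds_index : Type;
  ds_le : ds_index -> ds_index -> Prop;
  ds_le_refl : forall i, ds_le i i;
  ds_le_trans : forall i j k, ds_le i j -> ds_le j k -> ds_le i k;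
  ds_inhabited : inhabited ds_index;
  ds_directed : forall i j, exists k, ds_le i k /\ ds_le j k;
  ds_mod : ds_index -> lmodType R;
  ds_map : forall i j, ds_le i j -> {linear ds_mod i -> ds_mod j};
  ds_map_id : forall i (h : ds_le i i) x, ds_map h x = x;
  ds_map_comp : forall i j k (hij : ds_le i j) (hjk : ds_le j k)
      (hik : ds_le i k) x,
    ds_map hjk (ds_map hij x) = ds_map hik x }.

Section DirectLimit.
Variables (R : pzRingType) (S : directed_system R).

Definition dl_pre : Type := {i : ds_index S & ds_mod i}.
HB.instance Definition _ := gen_eqMixin dl_pre.
HB.instance Definition _ := gen_choiceMixin dl_pre.

Definition dl_rel (u v : dl_pre) : Prop :=
  exists k (hu : ds_le (tag u) k) (hv : ds_le (tag v) k),
    ds_map hu (tagged u) = ds_map hv (tagged v).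

Definition dl_relb (u v : dl_pre) : bool := `[< dl_rel u v >].

Lemma dl_rel_equiv : equiv_class_of dl_relb.
Proof.
split=> [u|u v|v u w].
- by apply/asboolP; exists (tag u), (ds_le_refl _), (ds_le_refl _).
- by apply/asboolP/asboolP => -[k [h [h' e]]]; exists k, h', h.
move=> /asboolP[k [hu [hv e]]] /asboolP[l [hv' [hw e']]]; apply/asboolP.
have [m [km lm]] := ds_directed k l.
exists m, (ds_le_trans hu km), (ds_le_trans hw lm).
rewrite -(ds_map_comp hu km) e -(ds_map_comp hw lm) -e'.
by rewrite !(ds_map_comp _ _ (ds_le_trans hv km)).
Qed.

Canonical dl_equiv := EquivRelPack dl_rel_equiv.

Definition direct_limit : Type := {eq_quot dl_equiv}.
HB.instance Definition _ := Choice.on direct_limit.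

Definition dl_in i (x : ds_mod i) : direct_limit :=
  \pi_({eq_quot dl_equiv}) (existT _ i x : dl_pre).

Lemma dl_inE i j (x : ds_mod i) (y : ds_mod j) :
  dl_in x = dl_in y <->
  exists k (hi : ds_le i k) (hj : ds_le j k), ds_map hi x = ds_map hj y.
Proof. by split=> [/eqmodP/asboolP|e]; last exact/eqmodP/asboolP. Qed.

Lemma dl_in_map i j (h : ds_le i j) (x : ds_mod i) :
  dl_in (ds_map h x) = dl_in x.
Proof.
by apply/dl_inE; exists j, (ds_le_refl j), h; rewrite ds_map_id.
Qed.

Lemma dl_in_surj (u : direct_limit) : exists i (x : ds_mod i), u = dl_in x.
Proof.
exists (tag (repr u)), (tagged (repr u)).
by rewrite /dl_in -[LHS]reprK; congr (\pi _); case: (repr u).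
Qed.

Lemma dl_in_surj2 (u v : direct_limit) :
  exists i (x y : ds_mod i), u = dl_in x /\ v = dl_in y.
Proof.
have [i [x ->]] := dl_in_surj u; have [j [y ->]] := dl_in_surj v.
have [k [ik jk]] := ds_directed i j.
by exists k, (ds_map ik x), (ds_map jk y); rewrite !dl_in_map.
Qed.

Definition dl_bound (i j : ds_index S) : {k | ds_le i k /\ ds_le j k} :=
  cid (ds_directed i j).

Definition dl_zero : direct_limit :=
  @dl_in (projT1 (cid (let: inhabits i := ds_inhabited S in
                       ex_intro (fun=> True) i I))) 0.

Definition dl_opp (u : direct_limit) : direct_limit :=
  dl_in (- tagged (repr u)).

Definition dl_scale (a : R) (u : direct_limit) : direct_limit :=
  dl_in (a *: tagged (repr u)).

Definition dl_add (u v : direct_limit) : direct_limit :=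
  let k := dl_bound (tag (repr u)) (tag (repr v)) in
  dl_in (ds_map (proj1 (svalP k)) (tagged (repr u))
         + ds_map (proj2 (svalP k)) (tagged (repr v))).

Lemma dl_in_repr i (x : ds_mod i) : exists k (h : ds_le (tag (repr (dl_in x))) k)
  (h' : ds_le i k), ds_map h (tagged (repr (dl_in x))) = ds_map h' x.
Proof.
apply/dl_inE; rewrite -[RHS]reprK /dl_in; congr (\pi _).
by case: (repr _).
Qed.

Lemma dl_zeroE i : dl_zero = dl_in (0 : ds_mod i).
Proof.
apply/dl_inE; set j := projT1 _; have [k [ik jk]] := ds_directed i j.
by exists k, jk, ik; rewrite !linear0.
Qed.

Lemma dl_oppE i (x : ds_mod i) : dl_opp (dl_in x) = dl_in (- x).
Proof.
have [k [h [h' e]]] := dl_in_repr x.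
by apply/dl_inE; exists k, h, h'; rewrite !linearN e.
Qed.

Lemma dl_scaleE a i (x : ds_mod i) : dl_scale a (dl_in x) = dl_in (a *: x).
Proof.
have [k [h [h' e]]] := dl_in_repr x.
by apply/dl_inE; exists k, h, h'; rewrite !linearZ /= e.
Qed.

Lemma dl_addE i (x y : ds_mod i) : dl_add (dl_in x) (dl_in y) = dl_in (x + y).
Proof.
rewrite /dl_add.
have [k [h [h' e]]] := dl_in_repr x; have [l [g [g' e']]] := dl_in_repr y.
move: (proj1 _) (proj2 _); move: (sval _) => m um vm.
have [p [kp lp]] := ds_directed k l; have [q [pq mq]] := ds_directed p m.
have kq := ds_le_trans kp pq; have lq := ds_le_trans lp pq.
apply/dl_inE; exists q, mq, (ds_le_trans h' kq); rewrite !linearD /=.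
rewrite (ds_map_comp um mq (ds_le_trans h kq)) -(ds_map_comp h kq) e.
rewrite (ds_map_comp vm mq (ds_le_trans g lq)) -(ds_map_comp g lq) e'.
by rewrite !(ds_map_comp _ _ (ds_le_trans h' kq)).
Qed.

Lemma dl_addA : associative dl_add.
Proof.
move=> u v w; have [i [x [y [-> ->]]]] := dl_in_surj2 u v.
have [j [z ->]] := dl_in_surj w; have [k [ik jk]] := ds_directed i j.
by rewrite -(dl_in_map ik x) -(dl_in_map ik y) -(dl_in_map jk z) !dl_addE addrA.
Qed.

Lemma dl_addC : commutative dl_add.
Proof.
move=> u v; have [i [x [y [-> ->]]]] := dl_in_surj2 u v.
by rewrite !dl_addE addrC.
Qed.

Lemma dl_add0 : left_id dl_zero dl_add.
Proof.
by move=> u; have [i [x ->]] := dl_in_surj u; rewrite (dl_zeroE i) dl_addE add0r.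
Qed.

Lemma dl_addN : left_inverse dl_zero dl_opp dl_add.
Proof.
move=> u; have [i [x ->]] := dl_in_surj u.
by rewrite (dl_zeroE i) dl_oppE dl_addE addNr.
Qed.

HB.instance Definition _ :=
  GRing.isZmodule.Build direct_limit dl_addA dl_addC dl_add0 dl_addN.

Lemma dl_scaleA a b u : dl_scale a (dl_scale b u) = dl_scale (a * b) u.
Proof.
by have [i [x ->]] := dl_in_surj u; rewrite !dl_scaleE scalerA.
Qed.

Lemma dl_scale1 : left_id 1 dl_scale.
Proof.
by move=> u; have [i [x ->]] := dl_in_surj u; rewrite !dl_scaleE scale1r.
Qed.

Lemma dl_scaleDr : right_distributive dl_scale +%R.
Proof.
move=> a u v; have [i [x [y [-> ->]]]] := dl_in_surj2 u v.
by rewrite /GRing.add /= dl_addE !dl_scaleE dl_addE scalerDr.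
Qed.

Lemma dl_scaleDl u : {morph dl_scale^~ u : a b / a + b}.
Proof.
move=> a b; have [i [x ->]] := dl_in_surj u.
by rewrite [RHS]/GRing.add /= !dl_scaleE dl_addE scalerDl.
Qed.

HB.instance Definition _ := GRing.Zmodule_isLmodule.Build R direct_limit
  dl_scaleA dl_scale1 dl_scaleDr dl_scaleDl.

Lemma dl_in_is_linear i : linear (@dl_in i).
Proof.
by move=> a x y; rewrite /GRing.add /= /GRing.scale /= dl_scaleE dl_addE.
Qed.

HB.instance Definition _ i := GRing.isLinear.Build R (ds_mod i) direct_limit
  *:%R (@dl_in i) (@dl_in_is_linear i).

End DirectLimit.

Section EndCohomology.
Variables (F : realType) (R : idomainType) (X : topologicalType).

Definition set_incl (A B : set X) (AB : A `<=` B) (x : A) : B :=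
  exist _ (val x) (mem_set (AB _ (set_valP x))).

Lemma set_incl_continuous (A B : set X) (AB : A `<=` B) :
  continuous (set_incl AB).
Proof. by apply: continuous_comp_initial; exact: initial_continuous. Qed.

Definition restriction (A B : set X) (AB : A `<=` B) :
    {linear singular_H0 F R B -> singular_H0 F R A} :=
  H0_pullback (mkcts (@set_incl_continuous A B AB)).

Definition compacta : Type := {K : set X | compact K}.

Definition compacta_le (K L : compacta) : Prop := sval K `<=` sval L.

Lemma compacta_directed (K L : compacta) :
  exists M, compacta_le K M /\ compacta_le L M.
Proof.
exists (exist _ (sval K `|` sval L) (compactU (svalP K) (svalP L))).
by split=> x ?; [left|right].
Qed.

Definition complement_restriction (K L : compacta) (KL : compacta_le K L) :
    {linear singular_H0 F R (~` sval K) -> singular_H0 F R (~` sval L)} :=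
  restriction (subsetC KL).

Lemma complement_restriction_id K (h : compacta_le K K) x :
  complement_restriction h x = x.
Proof.
apply: val_inj; apply/funext => s /=; congr (H0_cochain x _).
by apply/continuousEP => t; exact: val_inj.
Qed.

Lemma complement_restriction_comp K L M (KL : compacta_le K L)
    (LM : compacta_le L M) (KM : compacta_le K M) x :
  complement_restriction LM (complement_restriction KL x)
  = complement_restriction KM x.
Proof.
apply: val_inj; apply/funext => s /=; congr (H0_cochain x _).
by apply/continuousEP => t; exact: val_inj.
Qed.

Definition end_cohomology_system : directed_system R :=
  @DirectedSystem R compacta compacta_le
    (fun K => @subset_refl _ (sval K))
    (fun K L M => @subset_trans _ (sval L) (sval K) (sval M))
    (inhabits (exist _ set0 (@compact0 X)))
    compacta_directed
    (fun K => singular_H0 F R (~` sval K))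
    complement_restriction
    complement_restriction_id complement_restriction_comp.

Definition end_H0 : lmodType R := direct_limit end_cohomology_system.

End EndCohomology.

(* Main.v *)
(* A class in H^0 of an open set is a function that is constant along paths.
   Since X is locally path connected, it is constant on components, so
   a class [c] on X - L takes a single value on W_i as soon as L is contained in
   K_i; this value at the end W defines eta [c].
   Frontiers of compacta are compact, and every unbounded component of X - K_i
   meets a fixed compactum of X - K_i. Hence the bounded components of X - K_i
   have bounded union, every unbounded component carries an end, and a
   continuous function on E(X) depends only on W_j for some j. The first two
   facts give injectivity of eta, the third gives surjectivity.
   Local path connectedness (Mazurkiewicz, Moore, Menger) is proved by refining
   chains of small connected open sets: each chain gives a step function on the
   line, refinements stay close to it, and the limit exists by local
   compactness. *)
Require Import Defs.
From HB Require Import structures.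
From mathcomp Require Import all_boot all_order all_algebra.
From mathcomp Require Import all_classical all_reals all_analysis.
From mathcomp Require Import lra.

Set Implicit Arguments.
Unset Strict Implicit.
Unset Printing Implicit Defensive.

Import Order.TTheory GRing.Theory Num.Theory.
Import numFieldNormedType.Exports.

Local Open Scope classical_set_scope.
Local Open Scope ring_scope.

(** The points of [U] where [phi] agrees with [phi x] and those where it differs form two open sets,
    which cannot both meet [C]. With [T := Prop] this becomes clopen induction: a locally constant
    predicate has a single truth value along a connected set. *)
Lemma locally_constant_connected (X : topologicalType) (T : Type)
    (U C : set X) (phi : X -> T) :
  (forall x, U x -> \forall y \near x, U y /\ phi y = phi x) ->
  connected C -> C `<=` U -> forall x y, C x -> C y -> phi x = phi y.
Proof.
move=> phiU Cc CU x y Cx Cy.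
pose O (Q : Prop -> Prop) := [set z | U z /\ Q (phi z = phi x)].
have openO Q : open (O Q).
  rewrite openE => z [Uz Qz]; apply: filterS (phiU z Uz) => w [Uw e].
  by split=> //; rewrite e.
have eC : C `&` O id = C; last by move: Cy; rewrite -{1}eC => -[_ [_ ->]].
apply: Cc.
- by exists x; split=> //; split=> //; exact: CU.
- by exists (O id).
exists (~` O not); first exact: open_closedC.
apply/seteqP; split=> z [Cz].
  by move=> [Uz e]; split=> // -[].
by move=> nOz; split=> //; split; [exact: CU|apply: contrapT => ne; apply: nOz; split=> //; exact: CU].
Qed.

(** * Local path connectedness *)

Section LocalPaths.
Variables (F : realType) (X : topologicalType) (d : X -> X -> F).
Hypotheses (d_eq0 : forall x y, d x y = 0 <-> x = y)
  (d_sym : forall x y, d x y = d y x)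
  (d_tri : forall x y z, d x z <= d x y + d y z)
  (d_nbhs : forall (x : X) (A : set X),
     nbhs x A <-> exists2 e : F, 0 < e & [set y | d x y < e] `<=` A).

Let d0 x : d x x = 0. Proof. exact/d_eq0. Qed.

Let d_ball x e : 0 < e -> \forall y \near x, d x y < e.
Proof. by move=> e0; apply/d_nbhs; exists e. Qed.

(** Paths are parametrised by the whole line, with endpoints read at 0 and 1; jumping at 1 is enough
    to get both endpoints right. *)
Definition step_path (p q : X) (t : F) : X := if t < 1 then p else q.

Definition cat_path (f g : F -> X) (t : F) : X :=
  if t < 2^-1 then f (2 * t) else g (2 * t - 1).

(* [chain_path C e p q f]: [f] is a step function from [p] to [q] whose steps
   are pairs of points of a connected open set of diameter at most [e] inside
   [C]; it is the combinatorial data refined to produce a path. *)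
Inductive chain_path (C : set X) (e : F) : X -> X -> (F -> X) -> Prop :=
| chain_step p q D : open D -> connected D -> D `<=` C ->
    (forall a b, D a -> D b -> d a b <= e) -> D p -> D q ->
    chain_path C e p q (step_path p q)
| chain_cat p r q f g : chain_path C e p r f -> chain_path C e r q g ->
    chain_path C e p q (cat_path f g).

Lemma chain_path_sub (C C' : set X) e p q f :
  C `<=` C' -> chain_path C e p q f -> chain_path C' e p q f.
Proof.
move=> CC'; elim=> {p q f} [p q D oD cD DC De Dp Dq|p r q f g _ Hf _ Hg].
  by apply: (@chain_step _ _ _ _ D) => //; exact: subset_trans CC'.
exact: chain_cat Hf Hg.
Qed.

Lemma chain_path_in C e p q f t : chain_path C e p q f -> C (f t).
Proof.
move=> H; elim: H t => {p q f} [p q D _ _ DC _ Dp Dq|p r q f g _ Hf _ Hg] t.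
  by rewrite /step_path; case: ifP => _; exact: DC.
by rewrite /cat_path; case: ifP.
Qed.

Lemma chain_path0 C e p q f : chain_path C e p q f -> f 0 = p.
Proof.
elim=> {p q f} [p q D _ _ DC _ Dp Dq|p r q f g _ Hf _ Hg].
  by rewrite /step_path ltr01.
by rewrite /cat_path mulr0 invr_gt0 ltr0n.
Qed.

Lemma chain_path1 C e p q f : chain_path C e p q f -> f 1 = q.
Proof.
elim=> {p q f} [p q D _ _ DC _ Dp Dq|p r q f g _ Hf _ Hg].
  by rewrite /step_path ltxx.
rewrite /cat_path ifF; last by apply/negbTE; rewrite -leNgt; lra.
by rewrite -Hg; congr g; lra.
Qed.

(** This is the approximate continuity that survives in the limit: a jump stays inside one set of
    diameter at most [e], and concatenation creates no new jump. *)
Lemma chain_path_osc C e p q f : chain_path C e p q f ->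
  forall t, \forall s \near t, d (f s) (f t) <= e.
Proof.
elim=> {p q f} [p q D _ _ DC De Dp Dq|p r q f g Cf Hf Cg Hg] t.
  by near=> s; rewrite /step_path; case: ifP; case: ifP => _ _; exact: De.
have near_affine b (P : set F) :
    (\forall s \near 2 * t + b, P s) -> \forall s \near t, P (2 * s + b).
  suff : {for t, continuous (fun s : F => 2 * s + b)} by exact.
  by apply: cvgD; [apply: cvgM; [exact: cvg_cst|exact: cvg_id]|exact: cvg_cst].
have nearf : \forall s \near t, d (f (2 * s + 0)) (f (2 * t + 0)) <= e.
  exact: near_affine (Hf _).
have nearg : \forall s \near t, d (g (2 * s - 1)) (g (2 * t - 1)) <= e.
  exact: near_affine (Hg _).
rewrite /cat_path; case: (ltgtP t 2^-1) => [tlt|tgt|teq].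
- near=> s; rewrite ifT; last by near: s; exact: lt_nbhsl.
  by rewrite -[2 * s]addr0 -[2 * t]addr0; near: s.
- near=> s; rewrite ifF; first by near: s; exact: nearg.
  by apply/negbTE; rewrite -leNgt ltW //; near: s; exact: lt_nbhsr.
(* At the junction both halves pass through [r], so the two one-sided bounds refer to the same
   value. *)
- near=> s; rewrite -teq.
  have fs : d (f (2 * s + 0)) (f (2 * t + 0)) <= e by near: s.
  have gs : d (g (2 * s - 1)) (g (2 * t - 1)) <= e by near: s.
  rewrite !addr0 in fs.
  have f1 : f (2 * t) = r by rewrite -(chain_path1 Cf); congr f; lra.
  have g0 : g (2 * t - 1) = r by rewrite -(chain_path0 Cg); congr g; lra.
  by case: ifP => _ //; rewrite ?g0 -?f1.
Unshelve. all: by end_near.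
Qed.

Hypothesis X_lc : locally_connected_space X.

Lemma small_connected (C : set X) x e : open C -> C x -> 0 < e ->
  exists D : set X, [/\ open D, connected D, D `<=` C, D x &
    forall a b, D a -> D b -> d a b <= e].
Proof.
move=> oC Cx e0; have e20 : 0 < e / 2 by rewrite divr_gt0.
have [D [oD Dx cD DC]] := X_lc (filterI (open_nbhs_nbhs (conj oC Cx)) (d_ball x e20)).
exists D; split=> // [y /DC[]//|a b /DC[_ xa] /DC[_ xb]].
rewrite (le_trans (d_tri _ x _)) // d_sym.
by move: xa xb => /=; lra.
Qed.

(** Reachability from [p] is locally constant on [C], since two points of a small connected set
    differ by one extra step. *)
Lemma chain_path_ex (C : set X) e p q : open C -> connected C -> 0 < e ->
  C p -> C q -> exists f, chain_path C e p q f.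
Proof.
move=> oC cC e0 Cp Cq; pose reach z := exists f, chain_path C e p z f.
suff -> : (exists f, chain_path C e p q f) = reach p.
  have [D [oD cD DC Dp De]] := small_connected oC Cp e0.
  by exists (step_path p p); exact: (@chain_step _ _ _ _ D).
apply: (@locally_constant_connected _ _ C C reach) => // x Cx.
have [D [oD cD DC Dx De]] := small_connected oC Cx e0.
have step y z : D y -> D z -> reach y -> reach z.
  move=> Dy Dz [f Cf]; exists (cat_path f (step_path y z)).
  by apply: chain_cat Cf _; exact: (@chain_step _ _ _ _ D).
apply: filterS (open_nbhs_nbhs (conj oD Dx)) => y Dy; split; first exact: DC.
by apply/propext; split; exact: step.
Qed.

(** Each step is replaced by a finer chain inside its own set [D], over the same parameters, so no
    value moves by more than the diameter of [D]. *)
Lemma chain_path_refine (C : set X) e e' p q f : 0 < e' ->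
  chain_path C e p q f ->
  exists2 f', chain_path C e' p q f' & forall t, d (f t) (f' t) <= e.
Proof.
move=> e'0; elim=> {p q f} [p q D oD cD DC De Dp Dq|p r q f g _ [f' Cf df] _ [g' Cg dg]].
  have [f' Cf] := chain_path_ex oD cD e'0 Dp Dq.
  exists f' => [|t]; first exact: chain_path_sub Cf.
  apply: De; last exact: chain_path_in Cf.
  by rewrite /step_path; case: ifP.
exists (cat_path f' g') => [|t]; first exact: chain_cat Cf Cg.
by rewrite /cat_path; case: ifP.
Qed.

Lemma chain_path_seq (C : set X) p q : open C -> connected C -> C p -> C q ->
  exists f : nat -> F -> X,
    (forall n, chain_path C (2^-1 ^+ n) p q (f n)) /\
    forall n m t, (n <= m)%N -> d (f n t) (f m t) <= 2 * 2^-1 ^+ n.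
Proof.
move=> oC cC Cp Cq.
have e0 n : 0 < 2^-1 ^+ n :> F by rewrite exprn_gt0 // invr_gt0.
have [f0 Cf0] := chain_path_ex oC cC (e0 0%N) Cp Cq.
(* The refinement is stated for all pairs, trivially when [u.2] is not a chain, so that [choice]
   yields a function to iterate. *)
have next (u : nat * (F -> X)) : exists f', chain_path C (2^-1 ^+ u.1) p q u.2 ->
    chain_path C (2^-1 ^+ u.1.+1) p q f' /\
    forall t, d (u.2 t) (f' t) <= 2^-1 ^+ u.1.
  have [Cu|nCu] := pselect (chain_path C (2^-1 ^+ u.1) p q u.2).
    by have [f' ? ?] := chain_path_refine (e0 u.1.+1) Cu; exists f'.
  by exists u.2 => /nCu.
have [g gP] := choice next.
pose f := fix f n := if n is m.+1 then g (m, f m) else f0.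
have Cf n : chain_path C (2^-1 ^+ n) p q (f n).
  by elim: n => [|n IHn] //=; case: (gP (n, f n) IHn).
exists f; split=> // n m t nm.
(* The right-hand side is the geometric sum of [2^-1 ^+ k] for k from n to m - 1, which makes the
   induction on m telescope. *)
have : d (f n t) (f m t) <= 2 * 2^-1 ^+ n - 2 * 2^-1 ^+ m.
  rewrite -(subnK nm); elim: (m - n)%N => [|k IHk]; first by rewrite d0 subrr.
  have [_ /(_ t) /= dk] := gP ((k + n)%N, f (k + n)%N) (Cf _).
  rewrite addSn exprS; have := d_tri (f n t) (f (k + n)%N t) (f (k + n).+1 t).
  by rewrite /=; lra.
by have := e0 m; lra.
Qed.

Hypothesis X_lk : locally_compact [set: X].

Lemma locally_path_connected (U : set X) x : open U -> U x ->
  \forall y \near x, exists f : F -> X,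
    [/\ continuous f, forall t, U (f t), f 0 = x & f 1 = y].
Proof.
move=> oU Ux; have [M] : exists2 M, within [set: X] (nbhs x) M & compact M /\ closed M.
  exact: X_lk x I.
have -> : within [set: X] (nbhs x) M = nbhs x M.
  by rewrite /within /=; congr (nbhs x _); apply/funext => y; apply/propext; split=> [/(_ I)|My _].
move=> nM [cM _].
have [r r0 rMU] := (d_nbhs _ _).1 (filterI nM (open_nbhs_nbhs (conj oU Ux))).
have r20 : 0 < r / 2 by rewrite divr_gt0.
have [C [oC Cx cC CB]] := X_lc (d_ball x r20).
apply: filterS (open_nbhs_nbhs (conj oC Cx)) => y Cy.
have [f [Cf df]] := chain_path_seq oC cC Cx Cy.
have half1 : `|2^-1 : F| < 1 by rewrite ger0_norm; lra.
have small (e : F) : 0 < e -> exists n, 2^-1 ^+ n < e.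
  move=> e0; have /cvgrPdist_lt /(_ e e0) [N _ /(_ N (leqnn N)) /=] :=
    @cvg_geometric F 1 2^-1 half1.
  rewrite sub0r normrN /geometric /= mul1r => h; exists N.
  by apply: le_lt_trans h; rewrite ler_norm.
(* The approximants stay in the compact set [M]; the closed estimate between them passes to any
   cluster point. *)
have lim t : exists z, forall n, d (f n t) z <= 2 * 2^-1 ^+ n.
  have Mf n : M (f n t).
    have /CB /= xf := chain_path_in t (Cf n).
    by have [] := rMU (f n t); rewrite //=; lra.
  have [z [_ zf]] : M `&` cluster (f ^~ t @ \oo) !=set0.
    by apply: cM; exists 0%N => // m _; exact: Mf.
  exists z => n; rewrite leNgt; apply/negP => lt_n.
  have e0 : 0 < d (f n t) z - 2 * 2^-1 ^+ n by rewrite subr_gt0.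
  have tail : (f ^~ t @ \oo) [set w | d (f n t) w <= 2 * 2^-1 ^+ n].
    by exists n => // m /= nm; exact: df.
  have [w [/= fw zw]] := zf _ _ tail (d_ball z e0).
  by have := d_tri (f n t) w z; move: zw => /=; rewrite (d_sym z w); lra.
have [g gP] := choice lim.
have g_eq t z : (forall n, f n t = z) -> g t = z.
  move=> fz; apply/esym/d_eq0/eqP; rewrite eq_le; apply/andP; split; last first.
    by have := d_tri z (g t) z; rewrite d0 (d_sym (g t)); lra.
  rewrite leNgt; apply/negP => h; have [|n] := small (d z (g t) / 2); first by lra.
  by have := gP t n; rewrite fz; lra.
exists g; split.
(* Going from [g t] to [g s] through [f n t] and [f n s] costs 2 + 1 + 2 times [2^-1 ^+ n]. *)
- move=> t A /d_nbhs[e e0 eA]; have [|n ne] := small (e / 5); first by lra.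
  change (\forall s \near t, A (g s)); near=> s; apply: eA => /=.
  have st : d (f n s) (f n t) <= 2^-1 ^+ n.
    by near: s; exact: chain_path_osc (Cf n) t.
  have := gP t n; have := gP s n.
  rewrite (d_sym (f n s)) in st; have := d_sym (g t) (f n t).
  have := d_tri (g t) (f n t) (g s); have := d_tri (f n t) (f n s) (g s).
  by lra.
- move=> t; suff : d x (g t) < r by move=> /rMU[].
  (* The approximants lie within [r / 2] of [x], and the limit lies within [2 * 2^-1 ^+ n < r / 2]
     of them. *)
  have [|n ne] := small (r / 4); first by lra.
  have /CB /= := chain_path_in t (Cf n).
  by have := d_tri x (f n t) (g t); have := gP t n; lra.
- by apply: g_eq => n; exact: chain_path0 (Cf n).
- by apply: g_eq => n; exact: chain_path1 (Cf n).
Unshelve. all: by end_near.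
Qed.

End LocalPaths.

(** * Components of complements of compacta, and ends *)

(** A form of the finite subcover property. If [P A] failed, the sets [B] with [P (A \ B)] would
    form a proper filter containing [A], and a cluster point in [A] would contradict the local
    hypothesis. *)
Lemma compact_ind (X : topologicalType) (A : set X) (P : set X -> Prop) :
  compact A -> P set0 ->
  (forall B C, B `<=` C -> P C -> P B) ->
  (forall B C, P B -> P C -> P (B `|` C)) ->
  (forall x, A x -> exists2 B, nbhs x B & P B) -> P A.
Proof.
move=> cA P0 PS PU PA; apply: contrapT => nPA.
pose G := [set B | P (A `\` B)].
have FG : ProperFilter G.
  split; first by rewrite /G /= setD0.
  split; first by rewrite /G /= setDT.
    by move=> B C GB GC; rewrite /G /= setDIr; exact: PU.
  by move=> B C BC; apply: PS; exact: setDS.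
have [x [Ax Gx]] : A `&` cluster G !=set0.
  by apply: cA; rewrite /G /= setDv.
have [B xB PB] := PA x Ax.
have GB : G (~` B) by apply: PS PB => y [_] /contrapT.
by have [y []] := Gx _ _ GB xB.
Qed.

Section Components.
Variable X : topologicalType.

Lemma bounded_subset_le (A B : set X) :
  A `<=` B -> bounded_subset B -> bounded_subset A.
Proof.
move=> AB cB; apply: (subclosed_compact _ cB); first exact: closed_closure.
exact: closureS.
Qed.

Hypothesis X_gc : generalized_continuum X.

Let X_haus : hausdorff_space X. Proof. by case: X_gc. Qed.
Let X_conn : connected [set: X]. Proof. by case: X_gc. Qed.
Let X_lc : locally_connected_space X. Proof. by case: X_gc. Qed.

Lemma compact_bounded (A M : set X) :
  compact M -> A `<=` M -> bounded_subset A.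
Proof.
move=> cM AM; apply: bounded_subset_le AM _.
by rewrite /bounded_subset -(closure_id _).1 //; exact: compact_closed.
Qed.

Lemma compactC_open (A : set X) : compact A -> open (~` A).
Proof. by move=> cA; apply: closed_openC; exact: compact_closed. Qed.

Lemma component_sub (U C : set X) : is_component U C -> C `<=` U.
Proof. by move=> [x Ux ->]; exact: connected_component_sub. Qed.

Lemma connected_is_component (U C : set X) : is_component U C -> connected C.
Proof. by move=> [x Ux ->]; exact: component_connected. Qed.

Lemma connected_sub_component (U C D : set X) : is_component U C ->
  connected D -> D `<=` U -> C `&` D !=set0 -> D `<=` C.
Proof.
move=> [x Ux ->] cD DU [z [/same_connected_component -> Dz]].
exact: connected_component_max.
Qed.

Lemma is_component_connected_component (U : set X) x :
  U x -> is_component U (connected_component U x).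
Proof. by exists x. Qed.

Lemma open_component (U C : set X) : open U -> is_component U C -> open C.
Proof.
rewrite openE => oU UC x Cx.
have [V [oV Vx cV VU]] := X_lc (oU _ (component_sub UC Cx)).
apply: filterS (open_nbhs_nbhs (conj oV Vx)).
by apply: (connected_sub_component UC) => //; exists x.
Qed.

(* When [K] is nonempty [B] is the frontier of [L]: a component missing it
   leaves a clopen set once [L] is removed. *)
Lemma component_frontier (K L : set X) :
  compact K -> compact L -> K `<=` L^° ->
  exists B, [/\ compact B, B `<=` ~` K &
    forall C, is_component (~` K) C -> ~ C `<=` L -> C `&` B !=set0].
Proof.
move=> cK cL KL.
(* For empty [K] the only component is the whole connected space, so any singleton meets it. *)
have [->|/set0P[k Kk]] := eqVneq K set0.
  have [[x _]|X0] := pselect ([set: X] !=set0); last first.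
    exists set0; split=> [|//|C _]; first exact: compact0.
    by case=> x _; case: X0; exists x.
  exists [set x]; split=> [||C [y _ ->] _]; first exact: compact_set1.
    by rewrite setC0.
  exists x; split=> //; rewrite setC0.
  exact: (@connected_component_max _ _ setT).
exists (L `\` L^°); split=> [|z [_ nz] /KL//|C KC CL].
  by apply: compact_closedI => //; apply: open_closedC; exact: open_interior.
apply: contrapT => CB; apply: CL => z0 Cz0; apply: contrapT => Lz0.
pose D := C `\` L.
have CL z : C z -> L^° z \/ ~ L z.
  move=> Cz; have [Lz|] := pselect (L z); last by right.
  by left; apply: contrapT => nz; apply: CB; exists z.
(* [D] will be shown locally constant on the connected space, yet it holds at [z0] and fails at [k],
   a point of [K]. *)
have : D z0 = D k; last first.
  have -> : D k = False; last by move=> <-; split.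
  by apply/propext; split=> // -[/(component_sub KC)].
apply: (@locally_constant_connected _ _ setT setT) => // z _.
have [Lz|nLz] := pselect (L^° z).
  have : nbhs z L^° by apply: open_nbhs_nbhs; split=> //; exact: open_interior.
  apply: filterS => y Ly; split=> //.
  by apply/propext; split=> -[_ []]; exact: interior_subset.
have [V [oV Vz cV VK]] : exists V, [/\ open V, V z, connected V & V `<=` ~` K].
  by apply/X_lc/open_nbhs_nbhs; split; [exact: compactC_open|move/KL].
have [Cz|nCz] := pselect (C z).
  have oD : open D.
    apply: openI; last exact: compactC_open.
    by apply: open_component KC; exact: compactC_open.
  have Dz : D z by split=> //; case: (CL z Cz).
  apply: filterS (open_nbhs_nbhs (conj oD Dz)) => y Dy; split=> //.
  exact/propext.
apply: filterS (open_nbhs_nbhs (conj oV Vz)) => y Vy; split=> //.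
apply/propext; split=> -[Cy _]; exfalso; last by [].
by apply: nCz; apply: (connected_sub_component KC cV VK) => //; exists y.
Qed.

(** A component not inside [L] meets the compactum [B], which is covered by finitely many
    components; the closures of the bounded ones among them, together with [L], give [M]. *)
Lemma bounded_components (K L : set X) :
  compact K -> compact L -> K `<=` L^° ->
  exists M, [/\ compact M, K `<=` M &
    forall C, is_component (~` K) C -> bounded_subset C -> C `<=` M].
Proof.
move=> cK cL KL; have [B [cB BK BC]] := component_frontier cK cL KL.
pose P (A : set X) := exists2 M, compact M & forall C, is_component (~` K) C ->
  bounded_subset C -> C `&` A !=set0 -> C `<=` M.
have [M cM MP] : P B.
  apply: compact_ind cB _ _ _ _.
  - by exists set0 => [|C _ _ [x []]//]; exact: compact0.
  - move=> A A' AA' [M cM MP]; exists M => // C KC bC [x [Cx Ax]].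
    by apply: MP => //; exists x; split=> //; exact: AA'.
  - move=> A A' [M cM MP] [M' cM' MP']; exists (M `|` M'); first exact: compactU.
    move=> C KC bC [x [Cx [Ax|Ax]]].
      by apply: subset_trans (MP _ KC bC _) _; [exists x|exact: subsetUl].
    by apply: subset_trans (MP' _ KC bC _) _; [exists x|exact: subsetUr].
  move=> x /BK Kx; have xK := is_component_connected_component Kx.
  exists (connected_component (~` K) x).
    apply: open_nbhs_nbhs; split; last exact: connected_component_refl.
    by apply: open_component xK; exact: compactC_open.
  (* Only one component meets this neighbourhood of [x]: its closure serves if it is bounded, and
     the condition is vacuous otherwise. *)
  have [bx|nbx] := pselect (bounded_subset (connected_component (~` K) x)).
    exists (closure (connected_component (~` K) x)) => // C KC _ Cx.
    by rewrite (is_component_eq KC xK Cx); exact: subset_closure.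
  exists set0 => [|C KC bC Cx]; first exact: compact0.
  by case: nbx; rewrite -(is_component_eq KC xK Cx).
exists (L `|` M); split=> [|x /KL/interior_subset|C KC bC]; first exact: compactU.
  by left.
have [CL|CL] := pselect (C `<=` L); first by move=> x /CL; left.
by move=> x Cx; right; apply: (MP C) => //; exact: BC.
Qed.

(** * Unbounded components and ends along an exhaustion *)

Variable K : nat -> set X.
Hypothesis K_exh : compact_exhaustion K.

Let K_compact i : compact (K i). Proof. by case: K_exh. Qed.
Let K_int i : K i `<=` (K i.+1)^°. Proof. by case: K_exh. Qed.

Lemma exhaustion_le i j : (i <= j)%N -> K i `<=` K j.
Proof.
move=> /subnK <-; elim: (j - i)%N => // n IHn.
by apply: subset_trans IHn _; apply: subset_trans (@K_int _) _; exact: interior_subset.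
Qed.

Lemma compact_sub_exhaustion (L : set X) : compact L -> exists i, L `<=` K i.
Proof.
move=> cL; apply: (@compact_ind _ _ (fun A => exists i, A `<=` K i) cL).
- by exists 0%N.
- by move=> A B AB [i BK]; exists i; exact: subset_trans BK.
- move=> A B [i AK] [j BK]; exists (maxn i j) => x [/AK|/BK].
    exact: exhaustion_le (leq_maxl _ _) x.
  exact: exhaustion_le (leq_maxr _ _) x.
- move=> x _; have [_ _ /seteqP[_ /(_ x I)[i _ Kx]]] := K_exh.
  by exists (K i.+1); [exact: K_int|exists i.+1].
Qed.

(** The unbounded components are disjoint open sets all meeting one compactum, so each level has
    only finitely many; this is the compactness behind [locally_constant_end_level]. *)
Lemma unbounded_component_frontier i :
  exists B, [/\ compact B, B `<=` ~` K i &
    forall C, unbounded_component (~` K i) C -> C `&` B !=set0].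
Proof.
have [B [cB BK BC]] := component_frontier (@K_compact i) (@K_compact i.+1) (@K_int i).
exists B; split=> // C [KC nbC]; apply: BC => // CK.
exact/nbC/compact_bounded/CK.
Qed.

(** [V] is too large to fit in a compactum holding all bounded components of the next level, so it
    contains a point of an unbounded one. *)
Lemma unbounded_component_succ i V : unbounded_component (~` K i) V ->
  exists2 V', unbounded_component (~` K i.+1) V' & V' `<=` V.
Proof.
move=> [KV nbV].
have [M [cM KM MC]] := bounded_components (@K_compact i.+1) (@K_compact i.+2) (@K_int i.+1).
have [x Vx nMx] : exists2 x, V x & ~ M x.
  apply: contrapT => nx; apply/nbV/(compact_bounded cM) => x Vx.
  by apply: contrapT => nMx; apply: nx; exists x.
have Kx : (~` K i.+1) x by move/KM.
have xC := is_component_connected_component Kx.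
exists (connected_component (~` K i.+1) x).
  split=> // bC; apply/nMx/(MC _ xC bC); exact: connected_component_refl.
apply: (connected_sub_component KV); first exact: component_connected.
  apply: subset_trans (component_sub xC) _; apply: subsetC.
  exact: exhaustion_le.
by exists x; split=> //; exact: connected_component_refl.
Qed.

Lemma unbounded_component_end i V : unbounded_component (~` K i) V ->
  exists W : end_space K, W i = V.
Proof.
move=> uV.
have next (p : nat * set X) : exists V', unbounded_component (~` K p.1) p.2 ->
    unbounded_component (~` K p.1.+1) V' /\ V' `<=` p.2.
  have [/unbounded_component_succ[V' ? ?]|np] :=
    pselect (unbounded_component (~` K p.1) p.2); first by exists V'.
  by exists set0 => /np.
have [g gP] := choice next.
(* The descent starts at level [i], so [f n] is a component at level [n + i]. *)
pose f := fix f n := if n is m.+1 then g ((m + i)%N, f m) else V.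
have uf n : unbounded_component (~` K (n + i)%N) (f n).
  by elim: n => [//|n IHn]; case: (gP ((n + i)%N, f n) IHn).
have fS n : f n.+1 `<=` f n by case: (gP ((n + i)%N, f n) (uf n)).
have [x fx] : exists x : nat -> X, forall n, f n (x n).
  suff : forall n, exists x, f n x by move/choice => [x]; exists x.
  by move=> n; have [/is_component_neq0] := uf n.
have fK n : f n `<=` ~` K n.
  apply: subset_trans (component_sub (uf n).1) _; apply: subsetC.
  by apply: exhaustion_le; exact: leq_addr.
(* Enlarging [f n] to the component of level [n] around it realigns the indices and also supplies
   the levels below [i]. *)
pose W n := connected_component (~` K n) (x n).
have KW n : is_component (~` K n) (W n).
  by apply: is_component_connected_component; exact: fK.
have fW n : f n `<=` W n.
  by apply: connected_component_max => //; exact: connected_is_component (uf n).1.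
have uW n : unbounded_component (~` K n) (W n).
  split=> // bW; have [_] := uf n; apply; exact: bounded_subset_le bW.
have WS n : W n.+1 `<=` W n.
  apply: (connected_sub_component (KW n)); first exact: component_connected.
    by apply: subset_trans (component_sub (KW n.+1)) _; apply/subsetC/exhaustion_le.
  by exists (x n.+1); split; [apply/fW/fS|apply/fW].
exists (EndOf WS uW); apply: is_component_eq (KW i) uV.1 _.
exists (x i); split; first exact: fW.
have {uf fK fW WS uW KW W} fV n : f n `<=` V.
  by elim: n => // n IHn; exact: subset_trans (fS n) IHn.
exact: fV.
Qed.

Lemma end_nbhsP (W : end_space K) (A : set (end_space K)) :
  nbhs W A <-> exists i, [set W' : end_space K | W' i = W i] `<=` A.
Proof.
split.
  rewrite nbhsE; case=> O [[D Ddom <-] [p Dp Wp]] OA.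
  by exists p.1 => W' W'p; apply: OA; exists p => //; exact: etrans W'p Wp.
move=> [i WA]; rewrite nbhsE; exists (end_basis (i, W i)) => //.
split=> //; exists [set (i, W i)]; last by rewrite bigcup_set1.
by move=> _ ->; exact: end_unbounded.
Qed.

(* A function on the ends that is not determined by a finite level would, by
   compactness at every level, be undetermined along some end. *)
Lemma locally_constant_end_level (T : Type) (f : end_space K -> T) :
  (forall W, \forall W' \near W, f W' = f W) ->
  exists j, forall W W' : end_space K, W j = W' j -> f W = f W'.
Proof.
move=> fc; pose good j (W : end_space K) := forall W' : end_space K, W j = W' j -> f W = f W'.
have good_le i j W : (i <= j)%N -> good i W -> good j W.
  by move=> ij Wi W' /(end_eq_le ij); exact: Wi.
(* No single level determines [f] on all the ends passing through [V] at level [n]. *)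
pose bad n (V : set X) := forall j, exists2 W : end_space K, W n = V & ~ good j W.
have badP n (S : set (end_space K)) :
    (forall j, exists2 W, S W & ~ good j W) -> exists2 W, S W & bad n (W n).
  move=> Sbad; apply: contrapT => nbad.
  have [B [cB BK BC]] := unbounded_component_frontier n.
  (* If every component of level [n] had its own good level, compactness of [B] would provide a
     common one for all of [S]. *)
  pose P A := exists j, forall W, S W -> W n `&` A !=set0 -> good j W.
  suff [j Sj] : P B.
    have [W SW] := Sbad j; apply; apply: Sj => //; apply: BC; exact: end_unbounded.
  apply: (@compact_ind _ _ P cB).
  - by exists 0%N => W _ [x []].
  - move=> A A' AA' [j Aj]; exists j => W SW [x [Wx Ax]].
    by apply: Aj => //; exists x; split=> //; exact: AA'.
  - move=> A A' [j Aj] [j' Aj']; exists (maxn j j') => W SW [x [Wx [Ax|Ax]]].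
      by apply: good_le (leq_maxl _ _) (Aj _ SW _); exists x.
    by apply: good_le (leq_maxr _ _) (Aj' _ SW _); exists x.
  move=> x /BK Kx; have xC := is_component_connected_component Kx.
  exists (connected_component (~` K n) x).
    apply: open_nbhs_nbhs; split; last exact: connected_component_refl.
    by apply: open_component xC; exact: compactC_open.
  have WC (W : end_space K) : W n `&` connected_component (~` K n) x !=set0 ->
      W n = connected_component (~` K n) x.
    exact: is_component_eq (end_unbounded W n).1 xC.
  have [[W SW Wx]|nW] := pselect (exists2 W : end_space K, S W &
      W n = connected_component (~` K n) x); last first.
    by exists 0%N => W SW /WC Wx; case: nW; exists W.
  have /existsNP[j /forall2NP Wj] : ~ bad n (W n) by move=> bW; apply: nbad; exists W.
  exists j => W' SW' /WC W'x; apply: contrapT.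
  by case: (Wj W') => // []; rewrite W'x Wx.
apply: contrapT => /forallNP nj.
have [W0 _ bad0] : exists2 W : end_space K, setT W & bad 0%N (W 0%N).
  apply: badP => j; apply: contrapT => /forall2NP Sj; apply: (nj j) => W W'.
  by case: (Sj W) => [/(_ I)|/contrapT/(_ W')].
have next (p : nat * end_space K) : exists W' : end_space K, bad p.1 (p.2 p.1) ->
    W' p.1 = p.2 p.1 /\ bad p.1.+1 (W' p.1.+1).
  have [bp|nbp] := pselect (bad p.1 (p.2 p.1)); last by exists p.2 => /nbp.
  by have [W' W'p bW'] := badP p.1.+1 [set W : end_space K | W p.1 = p.2 p.1] bp; exists W'.
have [g gP] := choice next.
pose w := fix w n := if n is m.+1 then g (m, w m) else W0.
have badw n : bad n (w n n) by elim: n => // n IHn; case: (gP (n, w n) IHn).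
have wS n : w n.+1 n = w n n by case: (gP (n, w n) (badw n)).
(* Since [w n.+1] and [w n] agree at level [n], the diagonal is nested and forms an end that is bad
   at every level, against local constancy of [f] there. *)
pose W n := w n n.
have WS n : W n.+1 `<=` W n by rewrite {2}/W -wS; exact: end_decr.
pose E := EndOf WS (fun n => end_unbounded (w n) n).
have /end_nbhsP[i Ei] := fc E.
have [W' W'i] := badw i i; apply => W'' W'W''.
by rewrite (Ei W' W'i) (Ei W'') //= -W'W''.
Qed.

End Components.

(** * Singular cohomology in degree zero *)

Section SingularZero.
Variables (F : realType) (R : idomainType).

Definition point_simplex (Y : topologicalType) (y : Y) : singular_simplex F 0 Y :=
  mkcts (@cst_continuous (std_simplex F 0) Y y).

Lemma vertex_subproof : (const_mx 1 : 'rV[F]_1) \in std_simplex F 0.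
Proof. by apply/mem_set; split=> [i|]; rewrite ?big_ord1 mxE. Qed.

Definition vertex : std_simplex F 0 := exist _ (const_mx 1) vertex_subproof.

Definition simplex_coord n (i : 'I_n.+1) (x : std_simplex F n) : F :=
  (set_val x : 'rV[F]_n.+1) ord0 i.

Lemma simplex_coord_continuous n (i : 'I_n.+1) : continuous (@simplex_coord n i).
Proof.
move=> x; apply: (@continuous_comp _ _ _ set_val (fun z : 'rV[F]_n.+1 => z ord0 i)).
  exact: initial_continuous.
exact: coord_continuous.
Qed.

Lemma simplex_coord_face n (i : 'I_n.+2) k (x : std_simplex F n) :
  simplex_coord (lift i k) (face F i x) = simplex_coord k x.
Proof. by rewrite [LHS]mxE liftK. Qed.

Lemma simplex_coord_face0 n (i : 'I_n.+2) (x : std_simplex F n) :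
  simplex_coord i (face F i x) = 0.
Proof. by rewrite [LHS]mxE unlift_none. Qed.

Lemma std_simplex0_eq (v w : std_simplex F 0) : v = w.
Proof.
have coord (u : std_simplex F 0) : simplex_coord ord0 u = 1.
  have [_] : std_simplex F 0 (set_val u) by exact: set_valP.
  by rewrite big_ord_recl big_ord0 addr0.
apply: val_inj; apply/rowP => j; rewrite [j]ord1.
by have := coord v; rewrite -(coord w).
Qed.

Lemma simplex0_point (Y : topologicalType) (s : singular_simplex F 0 Y) v :
  s = point_simplex (s v).
Proof. by apply/continuousEP => w /=; rewrite (std_simplex0_eq w v). Qed.

(** This is the clamp of [t] to the interval from 0 to 1. It makes [edge] a continuous surjection
    from the line onto the 1-simplex, whose images are therefore connected. *)
Let ramp (t : F) : F := (1 + `|t| - `|t - 1|) / 2.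

Let edge_row (t : F) : 'rV[F]_2 :=
  \row_j (if j == ord0 then 1 - ramp t else ramp t).

Let edge_row_simplex t : edge_row t \in std_simplex F 1.
Proof.
apply/mem_set; split=> [j|]; last first.
  by rewrite big_ord_recl big_ord1 !mxE /= subrK.
by rewrite mxE /ramp; case: ifP => _; case: (ger0P t); case: (ger0P (t - 1)); lra.
Qed.

Let edge (t : F) : std_simplex F 1 := exist _ (edge_row t) (edge_row_simplex t).

Let edge_continuous : continuous edge.
Proof.
apply: continuous_comp_initial => t.
have ramp_continuous : {for t, continuous ramp}.
  apply: cvgM; last exact: cvg_cst.
  apply: cvgB; first apply: cvgD; first exact: cvg_cst.
    by apply: cvg_norm; exact: cvg_id.
  by apply: cvg_norm; apply: cvgB; [exact: cvg_id|exact: cvg_cst].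
have -> : set_val \o edge =
    (fun t => (1 - ramp t) *: delta_mx ord0 ord0 + ramp t *: delta_mx ord0 ord_max).
  apply/funext => s /=; apply/rowP => j; rewrite !mxE.
  by case: (unliftP ord0 j) => [k|] ->; rewrite ?[k]ord1 /= ?mulr1 ?mulr0 ?addr0 ?add0r.
by apply: cvgD; apply: cvgZr_tmp; [apply: cvgB => //; exact: cvg_cst|].
Qed.

Let edge_surj (v : std_simplex F 1) : edge (simplex_coord ord_max v) = v.
Proof.
have [v0] : std_simplex F 1 (set_val v) by exact: set_valP.
rewrite big_ord_recl big_ord1; set x := fun_of_matrix _ _ _; set y := fun_of_matrix _ _ _.
move=> v1.
have y_max : y = simplex_coord ord_max v.
  by rewrite /y /simplex_coord; congr (fun_of_matrix _ _ _); exact: val_inj.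
have x0 : 0 <= x := v0 ord0.
have y0 : 0 <= y by rewrite y_max; exact: v0.
have ramp_y : ramp y = y.
  by rewrite /ramp ger0_norm // ler0_norm; lra.
apply: val_inj; apply/rowP => j; rewrite -y_max mxE ramp_y.
case: (unliftP ord0 j) => [k ->|->] /=; first by rewrite [k]ord1.
by rewrite -v1 addrK.
Qed.

Lemma simplex_component (X : topologicalType) (A : set X)
    (s : singular_simplex F 1 A) v w :
  connected_component A (set_val (s v)) (set_val (s w)).
Proof.
pose h t := set_val (s (edge t)).
have Ah : range h `<=` A by move=> _ [t _ <-]; exact: set_valP.
have hc : connected (range h).
  apply: connected_continuous_connected.
    by apply/connected_intervalP.
  apply: continuous_subspaceT => t.
  apply: (@continuous_comp _ _ _ (s \o edge) set_val).
    by apply: continuous_comp; [exact: edge_continuous|exact: cts_fun].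
  exact: initial_continuous.
have hv u : range h (set_val (s u)) by exists (simplex_coord ord_max u); rewrite // /h edge_surj.
exact: (connected_component_max (hv v) Ah hc).
Qed.

Lemma coboundary0E (Y : topologicalType) (c : cochain F R 0 Y) s :
  coboundary c s = c (ctscomp s (face F ord0)) - c (ctscomp s (face F ord_max)).
Proof.
rewrite /coboundary big_ord_recl big_ord1 expr0 expr1 scale1r scaleN1r.
by rewrite (_ : lift ord0 ord0 = ord_max) //; exact: val_inj.
Qed.

(** Composing [f] with the last barycentric coordinate gives a 1-simplex. Its face [ord0] omits the
    first vertex and so sits at [f 1]; its face [ord_max] sits at [f 0]. *)
Lemma cocycle0_path (Y : topologicalType) (c : cochain F R 0 Y) (f : F -> Y) :
  c \in @cocycle0 F R Y -> continuous f ->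
  c (point_simplex (f 0)) = c (point_simplex (f 1)).
Proof.
rewrite unfold_in => /eqP c0 fc.
have fs : continuous (f \o @simplex_coord 1 ord_max).
  by move=> x; apply: continuous_comp; [exact: simplex_coord_continuous|exact: fc].
pose s : singular_simplex F 1 Y := mkcts fs.
have : coboundary c s = 0 by rewrite c0.
rewrite coboundary0E => /subr0_eq.
rewrite (simplex0_point (ctscomp s (face F ord0)) vertex).
rewrite (simplex0_point (ctscomp s (face F ord_max)) vertex).
have -> : ctscomp s (face F ord0) vertex = f 1.
  transitivity (f (simplex_coord ord_max (face F ord0 vertex))) => //; congr f.
  rewrite (_ : ord_max = lift ord0 ord0); last exact: val_inj.
  by rewrite simplex_coord_face [LHS]mxE.
have -> : ctscomp s (face F ord_max) vertex = f 0.
  transitivity (f (simplex_coord ord_max (face F ord_max vertex))) => //; congr f.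
  exact: simplex_coord_face0.
by move=> ->.
Qed.

End SingularZero.

(** * Evaluation at the ends *)

Lemma dl_in_tagged_repr (R : pzRingType) (S : directed_system R)
    (u : direct_limit S) : dl_in (tagged (repr u)) = u.
Proof.
by rewrite -[RHS]reprK /dl_in; congr (\pi _)%qT; case: (repr u).
Qed.

Section EndEvaluation.
Variables (F : realType) (R : idomainType) (X : topologicalType).

(* The value on the constant simplex at [x], extended by [0] outside [A]. *)
Definition H0_val (A : set X) (c : singular_H0 F R A) (x : X) : R :=
  if pselect (A x) is left Ax
  then H0_cochain c (point_simplex F (exist _ x (mem_set Ax) : A)) else 0.

Lemma H0_valE (A : set X) (c : singular_H0 F R A) (a : A) :
  H0_val c (set_val a) = H0_cochain c (point_simplex F a).
Proof.
rewrite /H0_val; case: pselect => [h|[]]; last exact: set_valP.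
by congr (H0_cochain c (point_simplex F _)); exact: val_inj.
Qed.

Lemma H0_val_inj (A : set X) (c c' : singular_H0 F R A) :
  (forall x, A x -> H0_val c x = H0_val c' x) -> c = c'.
Proof.
move=> cc'; apply: val_inj; apply/funext => s.
rewrite /= (simplex0_point s (vertex F)).
by rewrite -!H0_valE; apply: cc'; exact: set_valP.
Qed.

Lemma H0_val_linear (A : set X) a (c c' : singular_H0 F R A) x :
  H0_val (a *: c + c') x = a * H0_val c x + H0_val c' x.
Proof.
by rewrite /H0_val; case: pselect => // _; rewrite mulr0 addr0.
Qed.

Lemma H0_val_restriction (A B : set X) (AB : A `<=` B) (c : singular_H0 F R B) x :
  A x -> H0_val (restriction F R AB c) x = H0_val c x.
Proof.
move=> Ax; pose a : A := exist _ x (mem_set Ax).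
apply: etrans (H0_valE _ a) (etrans _ (esym (H0_valE c (set_incl AB a)))).
by rewrite /=; congr (H0_cochain c _); apply/continuousEP.
Qed.

Variable K : nat -> set X.
Hypotheses (X_gc : generalized_continuum X) (X_metr : metrizable X F)
  (K_exh : compact_exhaustion K).

(** Local path connectedness joins [z] to nearby points inside the open set [A], so the cocycle
    condition makes [H0_val c] locally constant. *)
Lemma H0_val_component (A C : set X) (c : singular_H0 F R A) x y :
  open A -> connected C -> C `<=` A -> C x -> C y -> H0_val c x = H0_val c y.
Proof.
move=> oA cC CA; apply: (locally_constant_connected _ cC CA) => z Az.
have [d [d_eq0 d_sym d_tri d_nbhs]] := X_metr; have [_ _ X_lc _ X_lk] := X_gc.
have nA := locally_path_connected d_eq0 d_sym d_tri d_nbhs X_lc X_lk oA Az.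
apply: filterS nA => w [f [fc fA f0 f1]].
split; first by rewrite -f1; exact: fA.
pose g t : A := exist _ (f t) (mem_set (fA t)).
have gc : continuous g by exact: continuous_comp_initial.
have := cocycle0_path (H0_cochainP c) gc.
rewrite -!H0_valE (_ : set_val (g 0) = z); last exact: f0.
by rewrite (_ : set_val (g 1) = w); last exact: f1.
Qed.

Notation S := (end_cohomology_system F R X).

(** Evaluation at an end depends neither on the representative, nor on the level, nor on the chosen
    point. *)
Lemma end_val_eq (L L' : compacta X) (c : singular_H0 F R (~` sval L))
    (c' : singular_H0 F R (~` sval L')) i j (W : end_space K) x y :
  dl_in (c : ds_mod (d := S) L) = dl_in (c' : ds_mod (d := S) L') ->
  sval L `<=` K i -> sval L' `<=` K j -> W i x -> W j y ->
  H0_val c x = H0_val c' y.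
Proof.
move=> /dl_inE[M [LM [L'M e]]] LK L'K Wx Wy.
have [m MK] := compact_sub_exhaustion K_exh (svalP M).
(* Far enough out, a point [z] of [W n] avoids [M], where the two classes already agree, and is
   joined to [x] within [W i] and to [y] within [W j]. *)
pose n := maxn m (maxn i j).
have [mn ijn] : (m <= n)%N /\ (maxn i j <= n)%N by apply/andP; rewrite -geq_max.
have [in_ jn] : (i <= n)%N /\ (j <= n)%N by apply/andP; rewrite -geq_max.
have [z Wz] : W n !=set0 by case: (end_unbounded W n) => /is_component_neq0.
have transfer (L0 : compacta X) (c0 : singular_H0 F R (~` sval L0)) k u :
    sval L0 `<=` K k -> (k <= n)%N -> W k u -> H0_val c0 u = H0_val c0 z.
  move=> L0K kn Wu; have [Wk _] := end_unbounded W k.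
  apply: (@H0_val_component _ (W k)) => //; last exact: end_decr_le kn z Wz.
  - exact: compactC_open (svalP L0).
  - exact: connected_is_component Wk.
  - by apply: subset_trans (component_sub Wk) _; exact: subsetC.
have Mz : (~` sval M) z.
  move=> /MK; have := component_sub (end_unbounded W m).1 (end_decr_le mn Wz).
  exact.
rewrite (transfer _ _ i) // (transfer _ _ j) //.
rewrite -(H0_val_restriction (subsetC LM)) //.
rewrite -(H0_val_restriction (subsetC L'M)) //.
exact: (congr1 (fun b : singular_H0 F R (~` sval M) => H0_val b z) e).
Qed.

Definition end_level (L : compacta X) : nat :=
  sval (cid (compact_sub_exhaustion K_exh (svalP L))).

Lemma end_levelP (L : compacta X) : sval L `<=` K (end_level L).
Proof. by rewrite /end_level; case: cid. Qed.

Definition end_point (W : end_space K) i : X :=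
  sval (cid (is_component_neq0 (end_unbounded W i).1)).

Lemma end_pointP (W : end_space K) i : W i (end_point W i).
Proof. by rewrite /end_point; case: cid. Qed.

(** The representative, level and point are arbitrary choices, made harmless by [end_val_eq]. *)
Definition end_eval (u : end_H0 F R X) (W : end_space K) : R^o :=
  H0_val (tagged (repr u) : singular_H0 F R (~` sval (tag (repr u))))
    (end_point W (end_level (tag (repr u)))).

Lemma end_evalE (L : compacta X) (c : singular_H0 F R (~` sval L)) i
    (W : end_space K) x :
  sval L `<=` K i -> W i x -> end_eval (dl_in (c : ds_mod (d := S) L)) W = H0_val c x.
Proof.
move=> LK Wx; apply: end_val_eq LK (end_pointP _ _) Wx; last exact: end_levelP.
exact: dl_in_tagged_repr.
Qed.

Lemma end_eval_continuous u : end_eval u \in @continuous_discrete (end_space K) R.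
Proof.
apply/continuous_discreteP => W; have [L [c ->]] := dl_in_surj u.
apply/(end_nbhsP); exists (end_level L) => W' /= W'W.
rewrite (@end_evalE _ _ (end_level L) _ (end_point W (end_level L))).
- by apply/esym/end_evalE; [exact: end_levelP|exact: end_pointP].
- exact: end_levelP.
- by rewrite W'W; exact: end_pointP.
Qed.

Definition end_contfun (u : end_H0 F R X) : contfun (end_space K) R :=
  ContFun (end_eval_continuous u).

Lemma end_contfun_linear : linear end_contfun.
Proof.
move=> a u v; apply: val_inj; apply/funext => W /=.
have [L [c [c' [-> ->]]]] := dl_in_surj2 u v.
pose x := end_point W (end_level L).
have E (b : singular_H0 F R (~` sval L)) :
    end_eval (dl_in (b : ds_mod (d := S) L)) W = H0_val b x.
  by apply: end_evalE (end_pointP _ _); exact: end_levelP.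
rewrite -linearP /= E H0_val_linear -!E.
by [].
Qed.

HB.instance Definition _ := GRing.isLinear.Build R (end_H0 F R X)
  (contfun (end_space K) R) *:%R end_contfun end_contfun_linear.

Lemma end_contfun_inj : injective end_contfun.
Proof.
apply: raddf_inj => u; have [L [c ->]] := dl_in_surj u => eta0.
pose i := end_level L; have [cK KS _] := K_exh.
(* Restriction to the complement of [M] kills [c]: a point outside [M] lies in an unbounded
   component, which carries an end, and the value there is zero. *)
have [M [cM KM MC]] := bounded_components X_gc (cK i) (cK i.+1) (KS i).
pose M' : compacta X := exist _ M cM.
have LM : compacta_le L M' by apply: subset_trans KM; exact: end_levelP.
rewrite -(dl_in_map (S := S) LM) -(linear0 (@dl_in _ S M')); congr dl_in.
apply: H0_val_inj => x Mx; rewrite H0_val_restriction //.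
have Kx : (~` K i) x by move/KM.
have xC := is_component_connected_component Kx.
have [|W Wi] := @unbounded_component_end _ X_gc _ K_exh i (connected_component (~` K i) x).
  by split=> // bC; apply/Mx/(MC _ xC bC); exact: connected_component_refl.
rewrite -(@end_evalE _ _ i W); last by rewrite Wi; exact: connected_component_refl.
  have -> : end_eval (dl_in (c : ds_mod (d := S) L)) W = 0.
    exact: (congr1 (fun f : contfun (end_space K) R => contfun_val f W) eta0).
  by rewrite /H0_val; case: pselect.
exact: end_levelP.
Qed.

Lemma end_contfun_surj (f : contfun (end_space K) R) : exists u, end_contfun u = f.
Proof.
have [cK _ _] := K_exh.
have [j fj] := locally_constant_end_level X_gc K_exh
  (elimT (continuous_discreteP f) (contfun_valP f)).
(* [g] reads [f] off the component at level [j]; components through which no end passes get the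
   default value 0. *)
pose g (C : set X) : R :=
  if pselect (exists W : end_space K, W j = C) is left h then f (sval (cid h)) else 0.
have gW (W : end_space K) : g (W j) = f W.
  rewrite /g; case: pselect => [h|[]]; last by exists W.
  by apply: fj; case: cid.
pose L : compacta X := exist _ (K j) (cK j).
pose c : cochain F R 0 (~` K j) :=
  fun s => g (connected_component (~` K j) (set_val (s (vertex F)))).
(* Both endpoints of a 1-simplex lie in the same component, on which [c] takes one value. *)
have c0 : c \in @cocycle0 F R (~` K j).
  rewrite unfold_in; apply/eqP/funext => s; rewrite coboundary0E; apply/eqP.
  rewrite subr_eq0; apply/eqP; congr g; apply: same_connected_component.
  exact: simplex_component.
exists (dl_in (SingularH0 c0 : ds_mod (d := S) L)).
apply: val_inj; apply/funext => W /=.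
rewrite (@end_evalE _ _ j W (end_point W j)) //; last exact: end_pointP.
have Wx := end_pointP W j; have [Wj _] := end_unbounded W j.
pose a : ~` K j := exist _ (end_point W j) (mem_set (component_sub Wj Wx)).
rewrite (H0_valE _ a) /= /c -gW; congr g.
have Kx := component_sub Wj Wx.
apply: (is_component_eq (is_component_connected_component Kx) Wj).
by exists (end_point W j); split=> //; exact: connected_component_refl.
Qed.

End EndEvaluation.

Theorem lemma7p4 (F : realType) (R : idomainType) (X : topologicalType)
    (K : nat -> set X) :
  is_PID R -> generalized_continuum X -> metrizable X F ->
  compact_exhaustion K ->
  exists eta : {linear end_H0 F R X -> contfun (end_space K) R}, bijective eta.
Proof.
move=> _ X_gc X_metr K_exh.
exists (end_contfun X_gc X_metr K_exh).
have [g gK] := choice (@end_contfun_surj F R X K X_gc X_metr K_exh).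
exists g => // u; apply: (@end_contfun_inj F R X K X_gc X_metr K_exh).
exact: gK.
Qed.
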